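(* In the 1-sided False Negative regime, given a moldgraph with $m$ edges and $n$ vertices, there exists an algorithm that finds a realized spanning tree using $O(m\log n)$ queries in expectation. If the moldgraph is $\rho$-sparse and minor-closed, the algorithm uses $O(\rho m)$ queries in expectation.
   Context: Problem (graph connectivity with noisy queries): a graph $G=(V,E)$, the moldgraph, with $n$ vertices and $m$ edges is given. An adversary selects an arbitrary connected spanning subgraph of $G$ to be realized. The algorithm may query an oracle on any edge $e$ (``Is $e$ realized?'') and receives ``Yes''/``No''; each query costs $1$, and answers to distinct queries (including repeated queries of the same edge) are independent. Goal: output a spanning tree of $G$ all of whose edges are realized. In the 1-sided False Negative regime: for a non-realized edge the answer is always ``No''; for a realized edge the answer is ``No'' with a constant probability $p<1/2$ and ``Yes'' with probability $1-p$ (so a ``Yes'' answer certifies the edge is realized). A graph with $m$ edges and $n$ vertices is $\rho$-sparse if $m\le\rho n$. A graph $H$ is a minor of $G$ if $H$ can be obtained from $G$ by edge deletions, vertex deletions and edge contractions; a family of graphs is minor-closed if it contains all minors of its members. ``The moldgraph is $\rho$-sparse and minor-closed'' means that it belongs to a minor-closed family of graphs all of whose members are $\rho$-sparse. *)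

(* Defs.v *)
From HB Require Import structures.
From mathcomp Require Import all_boot all_order all_algebra.
From mathcomp Require Import all_classical all_reals all_analysis.
Set Implicit Arguments. Unset Strict Implicit. Unset Printing Implicit Defensive.
Import Order.TTheory GRing.Theory Num.Theory numFieldNormedType.Exports.
Local Open Scope ring_scope.

Section Graphs.
Variable V : finType.

Definition simple_edges (E : {set {set V}}) : Prop :=
  forall e, e \in E -> #|e| = 2%N.

Definition sadj (E : {set {set V}}) : rel V :=
  fun x y => (x != y) && ([set x; y] \in E).

Definition gconnected (E : {set {set V}}) : Prop :=
  forall x y : V, connect (sadj E) x y.

Definition acyclic (E : {set {set V}}) : Prop :=
  ~ exists c : seq V, [/\ (2 < size c)%N, uniq c & cycle (sadj E) c].

Definition spanning_tree (E T : {set {set V}}) : Prop :=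
  [/\ T \subset E, gconnected T & acyclic T].

(* The state of the algorithm is the sequence of bits it has observed  *)
(* so far (oracle answers and its own fair coin flips); given it, a    *)
(* deterministic strategy chooses the next action.                     *)
Inductive action :=
| AQuery of {set V}
| AFlip
| AStop of {set {set V}}.

Definition strategy := seq bool -> action.

Definition is_query (a : action) : bool := if a is AQuery _ then true else false.
Definition is_stop (a : action) : bool := if a is AStop _ then true else false.

Variable R : realType.

(* 1-sided false negative oracle: realized edges answer "Yes" (true)
   w.p. 1-p and "No" w.p. p; non-realized edges always answer "No".
   Rz is the realized edge set. *)
Definition step_prob (p : R) (Rz : {set {set V}}) (a : action) (b : bool) : R :=
  match a with
  | AQuery e => if e \in Rz then (if b then 1 - p else p)
                else (if b then 0 else 1)
  | AFlip => 2^-1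
  | AStop _ => 0
  end.

Definition hist_prob (p : R) (Rz : {set {set V}}) (A : strategy) (h : seq bool) : R :=
  \prod_(i < size h) step_prob p Rz (A (take i h)) (nth false h i).

(* probability that the k-th action (0-based) is a query / is a stop *)
Definition query_mass p Rz (A : strategy) (k : nat) : R :=
  \sum_(h : k.-tuple bool | is_query (A h)) hist_prob p Rz A h.
Definition stop_mass p Rz (A : strategy) (k : nat) : R :=
  \sum_(h : k.-tuple bool | is_stop (A h)) hist_prob p Rz A h.

Definition expected_queries p Rz (A : strategy) : \bar R :=
  (\sum_(0 <= k <oo) (query_mass p Rz A k)%:E)%E.

Definition terminates_as p Rz (A : strategy) : Prop :=
  ((fun N : nat => \sum_(k < N) stop_mass p Rz A k) @ \oo --> (1 : R))%classic.

Definition always_correct (E : {set {set V}}) p Rz (A : strategy) : Prop :=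
  forall (h : seq bool) (T : {set {set V}}),
    0 < hist_prob p Rz A h -> A h = AStop T ->
    spanning_tree E T /\ T \subset Rz.

Definition finds_tree_within (E : {set {set V}}) (p : R) (A : strategy) (B : R) : Prop :=
  forall Rz : {set {set V}}, Rz \subset E -> gconnected Rz ->
    [/\ always_correct E p Rz A, terminates_as p Rz A
      & (expected_queries p Rz A <= B%:E)%E].

End Graphs.

Record graph := Graph { gV : finType; gE : {set {set gV}} }.

Definition isomorphic (G H : graph) : Prop :=
  exists h : gV G -> gV H, bijective h /\ gE H = [set h @: e | e : {set gV G} in gE G].

Definition del_edge (G : graph) (e : {set gV G}) : graph :=
  @Graph (gV G) (gE G :\ e).

Definition del_vertex (G : graph) (v : gV G) : graph :=
  @Graph {x : gV G | x != v}
    [set f : {set {x : gV G | x != v}} | val @: f \in gE G].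

Definition contract (G : graph) (u v : gV G) : graph :=
  @Graph {x : gV G | x != v}
    [set f : {set {x : gV G | x != v}} | (#|f| == 2)%N &&
       [exists e in gE G, [set (if x == v then u else x) | x in e] == val @: f]].

Inductive minor : graph -> graph -> Prop :=
| minor_iso G H : isomorphic G H -> minor H G
| minor_trans H K G : minor H K -> minor K G -> minor H G
| minor_del_edge G e : e \in gE G -> minor (@del_edge G e) G
| minor_del_vertex G v : minor (@del_vertex G v) G
| minor_contract G (u v : gV G) : u != v -> [set u; v] \in gE G ->
    minor (@contract G u v) G.

Definition minor_closed (F : graph -> Prop) : Prop :=
  forall G H, F G -> minor H G -> F H.

Definition sparse (R : realType) (rho : R) (G : graph) : Prop :=
  (#|gE G|%:R <= rho * #|gV G|%:R)%R.

(* Main.v *)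
(* Contract every edge answered "Yes". While the known realized edges K do not
   connect the graph, pick a component of K, query the edges leaving it cyclically
   until one "Yes", and merge. The expected cost is bounded by a potential of K.
   - In general, pick the component with the fewest leaving edges: with c
     components left it has at most 2m/c, and the harmonic sum over c is O(log n).
   - In a sparse minor-closed family, the simple graph obtained by contracting the
     components is a minor, so some component has at most 2 rho neighbours. Query
     the bundles of parallel edges towards these neighbours in round robin. If w
     is the size of the smallest bundle containing a realized edge, the expected
     waiting time is at most 2 rho w / (1 - p), and the answer contracts a bundle
     of at least w edges; these bundles are disjoint, so the total is O(rho m). *)

Require Import Defs.
From HB Require Import structures.
From mathcomp Require Import all_boot all_order all_algebra.
From mathcomp Require Import all_classical all_reals all_analysis.
From mathcomp Require Import ring lra zify.
(* Imported again so that finset lemmas shadow the homonyms of classical_sets. *)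
From mathcomp Require Import fintype finset.
Import Order.TTheory GRing.Theory Num.Theory numFieldNormedType.Exports.
Local Open Scope ring_scope.

Set Implicit Arguments.
Unset Strict Implicit.
Unset Printing Implicit Defensive.

(** * Additive drift: a potential bounds the expected number of queries *)

Section Drift.
Variables (V : finType) (R : realType) (p : R) (Rz : {set {set V}}).
Variable A : strategy V.
Hypotheses (p_ge0 : 0 <= p) (p_le1 : p <= 1).
Hypothesis no_flip : forall h, A h <> AFlip V.

Local Notation prob := (hist_prob p Rz A).
Local Notation step h := (step_prob p Rz (A h)).

Lemma sum_tuple_rcons (k : nat) (F : seq bool -> R) :
  \sum_(h : k.+1.-tuple bool) F h =
  \sum_(h : k.-tuple bool) (F (rcons h true) + F (rcons h false)).
Proof.
transitivity (\sum_(h : k.-tuple bool) \sum_(b : bool) F (rcons h b)); last first.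
  by apply: eq_bigr => h _; rewrite big_bool.
rewrite pair_big /=.
rewrite (reindex (fun q : k.-tuple bool * bool => [tuple of rcons q.1 q.2])) //=.
exists (fun t : k.+1.-tuple bool =>
  ([tuple of belast (thead t) (behead_tuple t)], last (thead t) (behead t))).
- move=> [h b] _ /=; congr (_, _); last first.
    by case: h => -[|x s] i //=; rewrite last_rcons.
  apply: val_inj; case: h => -[|x s] i //=; rewrite ?belast_rcons //.
- by move=> t _; apply: val_inj; rewrite /= -lastI; case/tupleP: t => x s /=.
Qed.

Lemma hist_prob_rcons h b : prob (rcons h b) = prob h * step h b.
Proof.
rewrite /hist_prob size_rcons big_ord_recr /=.
congr (_ * _); last first.
  by rewrite nth_rcons ltnn eqxx -cats1 take_size_cat.
apply: eq_bigr => i _; rewrite nth_rcons ltn_ord -cats1.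
by rewrite takel_cat // ltnW.
Qed.

Lemma step_prob_ge0 a b : 0 <= step_prob p Rz a b.
Proof.
case: a => [e||T] /=; last by [].
  by case: ifP => _; case: b; rewrite /= ?subr_ge0.
by rewrite invr_ge0.
Qed.

Lemma hist_prob_ge0 h : 0 <= prob h.
Proof. by apply: prodr_ge0 => i _; apply: step_prob_ge0. Qed.

(** A flip would also have total 1 without counting as a query; [no_flip] excludes it, so mass is
    lost only by stopping. *)
Lemma step_prob_total h :
  step h true + step h false = (is_query (A h))%:R.
Proof.
case E : (A h) => [e||T] /=; [|by have := no_flip E|by rewrite addr0].
by case: ifP => _; rewrite ?add0r ?subrK.
Qed.

Lemma query_mass_ge0 k : 0 <= query_mass p Rz A k.
Proof. by apply: sumr_ge0 => h _; apply: hist_prob_ge0. Qed.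

(** The probability that the first [k] actions are all queries, as both continuations of a stop have
    probability 0. *)
Definition mass k : R := \sum_(h : k.-tuple bool) prob h.

Lemma mass0 : mass 0 = 1.
Proof.
rewrite /mass (big_pred1 [tuple]) => [|t]; last exact/esym/eqP/tuple0.
by rewrite /hist_prob big_ord0.
Qed.

Lemma massS k : mass k.+1 = query_mass p Rz A k.
Proof.
rewrite /mass sum_tuple_rcons /query_mass [RHS]big_mkcond.
apply: eq_bigr => h _; rewrite !hist_prob_rcons -mulrDr step_prob_total.
by case: (is_query _); rewrite ?mulr1 ?mulr0.
Qed.

Lemma stop_massE k : stop_mass p Rz A k = mass k - mass k.+1.
Proof.
rewrite massS /mass /stop_mass /query_mass.
rewrite [X in _ = X - _](bigID (fun h : k.-tuple bool => is_query (A h))) /=.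
rewrite [RHS]addrAC subrr add0r; apply: eq_bigl => h.
by case E : (A h) => [e||T] //; have := no_flip E.
Qed.

Variable Phi : seq bool -> R.
Hypothesis Phi_ge0 : forall h, 0 < prob h -> 0 <= Phi h.
Hypothesis Phi_drift : forall h e, 0 < prob h -> A h = AQuery e ->
  1 + (step h true * Phi (rcons h true) + step h false * Phi (rcons h false))
    <= Phi h.

Let EPhi k : R := \sum_(h : k.-tuple bool) prob h * Phi h.

Let EPhi_ge0 k : 0 <= EPhi k.
Proof.
apply: sumr_ge0 => h _; have := hist_prob_ge0 h.
rewrite le_eqVlt => /orP[/eqP <-|h0]; first by rewrite mul0r.
by rewrite mulr_ge0 ?Phi_ge0 // ltW.
Qed.

Let EPhi_drop k : query_mass p Rz A k + EPhi k.+1 <= EPhi k.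
Proof.
rewrite /EPhi (sum_tuple_rcons k (fun h => prob h * Phi h)).
rewrite /query_mass [X in X + _]big_mkcond -big_split /=.
apply: ler_sum => h _; rewrite !hist_prob_rcons.
have := hist_prob_ge0 h; rewrite le_eqVlt => /orP[/eqP <-|h0].
  by rewrite !mul0r !addr0; case: ifP.
case E : (A h) => [e||T] /=; [|by have := no_flip E|]; last first.
  by rewrite !mulr0 !mul0r !addr0 mulr_ge0 ?Phi_ge0 // ltW.
have := Phi_drift h0 E; rewrite E /= => D.
by rewrite -!mulrA -mulrDr -[X in X + _]mulr1 -mulrDr ler_pM2l.
Qed.

Let sum_query_le N : \sum_(0 <= k < N) query_mass p Rz A k <= Phi [::].
Proof.
(* Telescoping [EPhi_drop]; the potential remaining at time [N] is nonnegative. *)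
suff H : \sum_(0 <= k < N) query_mass p Rz A k + EPhi N <= EPhi 0.
  have E0 : EPhi 0 = Phi [::].
    rewrite /EPhi (big_pred1 [tuple]) => [|t]; last exact/esym/eqP/tuple0.
    by rewrite /hist_prob big_ord0 mul1r.
  by rewrite -E0; apply: le_trans H; rewrite lerDl.
elim: N => [|N IH]; first by rewrite big_nil add0r.
rewrite big_nat_recr //= -addrA; apply: le_trans IH.
by rewrite lerD2l EPhi_drop.
Qed.

Lemma drift_expected_queries : (expected_queries p Rz A <= (Phi [::])%:E)%E.
Proof.
rewrite /expected_queries; apply: lime_le.
  by apply: is_cvg_nneseries => n _ _; rewrite lee_fin query_mass_ge0.
by apply: nearW => N; rewrite sumEFin lee_fin.
Qed.

(** The query masses have bounded partial sums, so they tend to 0. By [massS] they are the shifted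
    survival probabilities, and the stop masses telescope to [1 - mass N]. *)
Lemma drift_terminates : terminates_as p Rz A.
Proof.
have cvg_q : cvgn (series (query_mass p Rz A)).
  apply: nondecreasing_is_cvgn.
    apply/nondecreasing_seqP => n.
    by rewrite /series /= big_nat_recr //= lerDl query_mass_ge0.
  by exists (Phi [::]) => _ [N _ <-]; apply: sum_query_le.
have q0 := cvg_series_cvg_0 cvg_q.
have m0 : (mass @ \oo --> (0 : R))%classic.
  rewrite -cvg_shiftS /=.
  have -> // : (fun n => mass n.+1) = query_mass p Rz A by apply/funext => n; apply: massS.
rewrite /terminates_as.
have -> : (fun N : nat => \sum_(k < N) stop_mass p Rz A k) = (fun N => 1 - mass N).
  apply/funext => N; elim: N => [|N IH]; first by rewrite big_ord0 mass0 subrr.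
  by rewrite big_ord_recr /= IH stop_massE; ring.
rewrite -[X in (_ --> X)%classic]subr0.
by apply: cvgB => //; apply: cvg_cst.
Qed.

End Drift.

(** * Reachability, redundant edges and spanning trees *)

Lemma connect_leaves (T : finType) (e : rel T) (P : pred T) x y :
  connect e x y -> P x -> ~~ P y -> exists a b, [/\ e a b, P a & ~~ P b].
Proof.
case/connectP => s; elim: s x => [|z s IH] x /=; first by move=> _ -> ->.
case/andP=> exz ps yE Px nPy; case Pz : (P z); first exact: IH ps yE Pz nPy.
by exists x, z; rewrite exz Px Pz.
Qed.


Lemma connect_invariant (T : finType) (rT : Type) (e : rel T) (f : T -> rT) x y :
  (forall a b, e a b -> f a = f b) -> connect e x y -> f x = f y.
Proof.
move=> fE /connectP[s]; elim: s x => [|z s IH] x /=; first by move=> _ ->.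
by case/andP=> /fE -> ps /(IH _ ps).
Qed.

Section Connectivity.
Variable V : finType.
Implicit Types (E K T e : {set {set V}}) (u v x y : V).

Lemma sadj_sym K : symmetric (sadj K).
Proof. by move=> x y; rewrite /sadj eq_sym setUC. Qed.

Lemma sadj_connect_sym K : connect_sym (sadj K).
Proof. exact/sym_connect_sym/sadj_sym. Qed.

Lemma sadj_sub K T : K \subset T -> subrel (sadj K) (sadj T).
Proof. by move=> sKT x y /andP[xy /(subsetP sKT) xyT]; apply/andP. Qed.

Lemma connect_sadj_sub K T : K \subset T ->
  subrel (connect (sadj K)) (connect (sadj T)).
Proof.
by move=> s; apply: connect_sub => x y /(sadj_sub s); apply: connect1.
Qed.

(** On a cycle [x, y, z, ...] the way back from [z] to [x] avoids [y], and the edge [yz] differs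
    from [xy] because [z] is not [x]. *)
Lemma cycle_edge_redundant T (c : seq V) :
  (2 < size c)%N -> uniq c -> cycle (sadj T) c ->
  exists x y, sadj T x y /\ connect (sadj (T :\ [set x; y])) x y.
Proof.
case: c => [|x [|y [|z s]]] // _ Uc /= /and3P[xy yz zs].
exists x, y; split=> //.
have {Uc} [yx zx ys] : [/\ x != y, z != x & y \notin z :: s].
  move: Uc; rewrite /= !inE !negb_or => /and3P[/and3P[-> xz _] -> _].
  by rewrite eq_sym xz.
have keep a b : sadj T a b -> a != y -> b != y ->
  sadj (T :\ [set x; y]) a b.
  move=> /andP[ab abT] ay by_; rewrite /sadj ab !inE abT andbT /=.
  apply/eqP => /setP /(_ y); rewrite !inE eqxx orbT.
  by rewrite eq_sym (negPf ay) eq_sym (negPf by_).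
rewrite sadj_connect_sym; apply: (@connect_trans _ _ z).
  apply: connect1; case/andP: yz => yz yzT; rewrite /sadj yz !inE yzT andbT /=.
  apply/eqP => /setP /(_ z); rewrite !inE eqxx orbT (negPf zx) /=.
  by rewrite eq_sym (negPf yz).
apply/connectP; exists (rcons s x); last by rewrite last_rcons.
apply: (@sub_in_path _ (fun a => a != y) (sadj T)) zs.
  by move=> a b ay by_ ab; apply: keep.
rewrite -rcons_cons all_rcons yx andTb.
by apply/allP => a aS; apply: contraNneq ys => <-.
Qed.

Lemma connect_remove_redundant T x y :
  connect (sadj (T :\ [set x; y])) x y ->
  subrel (connect (sadj T)) (connect (sadj (T :\ [set x; y]))).
Proof.
move=> cxy; apply: connect_sub => a b /andP[ab abT].
have [E|nE] := eqVneq [set a; b] [set x; y]; last first.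
  by apply: connect1; rewrite /sadj ab !inE nE.
have aE : a \in [set x; y] by rewrite -E set21.
have bE : b \in [set x; y] by rewrite -E set22.
move: aE bE ab; rewrite !inE => /orP[]/eqP-> /orP[]/eqP->; rewrite ?eqxx //.
by rewrite sadj_connect_sym.
Qed.

(** An inclusion-minimal connected subset has no redundant edge, hence no cycle. *)
Lemma spanning_tree_exists E : gconnected E ->
  exists T, T \subset E /\ (gconnected T /\ acyclic T).
Proof.
move=> cE; have PE : `[< gconnected E >] by apply/asboolP.
have [T /minsetP[/asboolP cT minT] sTE] := minset_exists (P := fun T => `[< gconnected T >]) PE.
exists T; split=> //; split=> // -[c [sc Uc cc]].
have [x [y [xy cxy]]] := cycle_edge_redundant sc Uc cc.
have /minT : `[< gconnected (T :\ [set x; y]) >].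
  by apply/asboolP => a b; apply: connect_remove_redundant.
move=> /(_ (subD1set _ _)) /setP /(_ [set x; y]).
by rewrite !inE eqxx; case/andP: xy => _ ->.
Qed.

Lemma notconnected_from K x : ~ gconnected K -> exists y, ~~ connect (sadj K) x y.
Proof.
move=> nK; apply/existsP; apply: contra_notT nK => /existsPn H.
move=> a b; apply: (@connect_trans _ _ x); last exact/negPn/H.
by rewrite sadj_connect_sym; apply/negPn/H.
Qed.

Lemma realized_leaving Rz K x : gconnected Rz -> ~ gconnected K ->
  exists a b, [/\ [set a; b] \in Rz, connect (sadj K) x a & ~~ connect (sadj K) x b].
Proof.
move=> cR /(notconnected_from x)[y nxy].
have [//|a [b [/andP[_ ab] xa nxb]]] :=
  connect_leaves (P := connect (sadj K) x) (cR x y) _ nxy.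
by exists a, b.
Qed.

Lemma connect_add_edge K u v : u != v ->
  connect (sadj ([set u; v] |: K)) u v.
Proof. by move=> uv; apply: connect1; rewrite /sadj uv !inE eqxx. Qed.

End Connectivity.

(** * Strategies following a schedule that depends on the known edges *)

Section ScheduledQueries.
Variables (V : finType) (R : realType) (p : R) (E : {set {set V}}).
Implicit Types (K : {set {set V}}) (h : seq bool).
Variable Psi : {set {set V}} -> R.
Hypotheses (p_ge0 : 0 <= p) (p_lt1 : p < 1).
Hypothesis Psi_ge0 : forall K, 0 <= Psi K.

Variable sched : {set {set V}} -> nat -> {set V}.

Local Notation state := ({set {set V}} * nat)%type.

(** The counter is the number of [No] answers since the last [Yes]; every [Yes] restarts the
    schedule for the enlarged edge set. *)
Definition next_state (s : state) (b : bool) : state :=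
  if b then (sched s.1 s.2 |: s.1, 0) else (s.1, s.2.+1).

Definition state_of (h : seq bool) : state := foldl next_state (set0, 0) h.

Definition tree_of (K : {set {set V}}) : {set {set V}} :=
  xget set0 [set T : {set {set V}} | T \subset K /\ (gconnected T /\ acyclic T)]%classic.

Definition sched_strategy : strategy V := fun h =>
  let s := state_of h in
  if `[< gconnected s.1 >] then AStop (tree_of s.1) else AQuery (sched s.1 s.2).

Local Notation A := sched_strategy.

Lemma tree_ofP K : gconnected K ->
  tree_of K \subset K /\ (gconnected (tree_of K) /\ acyclic (tree_of K)).
Proof. by move=> cK; apply: (xgetPex set0 (spanning_tree_exists cK)). Qed.

Lemma state_of_rcons h b : state_of (rcons h b) = next_state (state_of h) b.
Proof. by rewrite /state_of -cats1 foldl_cat. Qed.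

Lemma sched_no_flip h : A h <> AFlip V.
Proof. by rewrite /A; case: ifP. Qed.

Variable Rz : {set {set V}}.
Local Notation prob := (hist_prob p Rz A).

(** One-sidedness: a [Yes] on a non-realized edge has probability 0. *)
Lemma state_realized h : 0 < prob h -> (state_of h).1 \subset Rz.
Proof.
elim/last_ind: h => [|h b IH]; first by rewrite sub0set.
have p_le1 := ltW p_lt1.
rewrite hist_prob_rcons state_of_rcons => hb.
have h0 : 0 < prob h.
  rewrite lt_neqAle hist_prob_ge0 // andbT.
  by apply: contraTneq hb => <-; rewrite mul0r ltxx.
move: hb (IH h0); rewrite pmulr_rgt0 // /next_state /A.
case: b => //=; case: ifP => _ /=; first by rewrite ltxx.
by case: ifP => [eR _|_]; rewrite ?ltxx // subUset sub1set eR.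
Qed.

(** These depend on the unknown [Rz] and belong to the analysis, whereas [sched] is fixed
    beforehand. Any window of [L K] queries tries the realized edge [es K], and any [Yes] must
    release [L K / (1 - p)] of [Psi]. *)
Variables (L : {set {set V}} -> nat) (es : {set {set V}} -> {set V}).
Hypothesis es_realized : forall (K : {set {set V}}), K \subset Rz -> ~ gconnected K -> es K \in Rz.
Hypothesis es_frequent : forall (K : {set {set V}}) (t : nat), K \subset Rz -> ~ gconnected K ->
  exists j, (j < L K)%N && (sched K (t + j) == es K).
Hypothesis Psi_drop : forall (K : {set {set V}}) (t : nat), K \subset Rz -> ~ gconnected K ->
  sched K t \in Rz -> Psi (sched K t |: K) + (L K)%:R / (1 - p) <= Psi K.

Definition wait (K : {set {set V}}) (t : nat) : nat :=
  find (fun j => sched K (t + j) == es K) (iota 0 (L K)).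

Lemma wait_lt K t : K \subset Rz -> ~ gconnected K -> (wait K t < L K)%N.
Proof.
move=> sK nK; rewrite -[X in (_ < X)%N](size_iota 0) -has_find.
have [j /andP[jL jE]] := es_frequent t sK nK.
by apply/hasP; exists j; rewrite ?mem_iota ?add0n.
Qed.

Lemma wait_least K t j : (sched K (t + j) == es K) -> (j < L K)%N -> (wait K t <= j)%N.
Proof.
move=> jE jL; rewrite leqNgt; apply/negP => /(before_find 0).
by rewrite nth_iota // jE.
Qed.

Lemma sched_wait K t : K \subset Rz -> ~ gconnected K ->
  sched K (t + wait K t) = es K.
Proof.
move=> sK nK; have wL := wait_lt t sK nK; apply/eqP.
have := nth_find 0 (a := fun j => sched K (t + j) == es K) (s := iota 0 (L K)).
by rewrite has_find size_iota => /(_ wL); rewrite nth_iota.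
Qed.

(* The expected remaining cost [L / (1 - p)] of a restarted wait, paid by [Psi],
   is [wait + 1 + p / (1 - p) * L] after some failures, and
   [p / (1 - p) * L - L / (1 - p) = - L]. *)
Definition sched_potential (s : state) : R :=
  if `[< gconnected s.1 >] then 0
  else Psi s.1 - (L s.1)%:R + (wait s.1 s.2)%:R + 1.

Lemma sched_potential_le K t : K \subset Rz -> sched_potential (K, t) <= Psi K.
Proof.
rewrite /sched_potential /= => sK; case: asboolP => // nK.
have := wait_lt t sK nK; rewrite -(ler_nat R) -natr1 => ?; lra.
Qed.

(** [es K] is scheduled and realized, so [Psi_drop] applies to it, and the potential left afterwards
    is nonnegative. *)
Lemma L_le_Psi K : K \subset Rz -> ~ gconnected K -> (L K)%:R / (1 - p) <= Psi K.
Proof.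
move=> sK nK; have := sched_wait 0 sK nK; rewrite add0n => wE.
have := es_realized sK nK; rewrite -wE => /(Psi_drop sK nK).
by apply: le_trans; rewrite lerDr.
Qed.

Lemma L_le_scaled K : (L K)%:R <= (L K)%:R / (1 - p) :> R.
Proof.
rewrite ler_pdivlMr ?subr_gt0 // ler_piMr //.
by rewrite lerBlDr lerDl.
Qed.

Lemma sched_potential_ge0 K t : K \subset Rz -> 0 <= sched_potential (K, t).
Proof.
rewrite /sched_potential /= => sK; case: asboolP => // nK.
have := L_le_Psi sK nK; have := L_le_scaled K.
have : 0 <= (wait K t)%:R :> R by [].
lra.
Qed.

Lemma sched_potential_drift h e : 0 < prob h -> A h = AQuery e ->
  1 + (step_prob p Rz (A h) true * sched_potential (state_of (rcons h true)) +
       step_prob p Rz (A h) false * sched_potential (state_of (rcons h false)))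
  <= sched_potential (state_of h).
Proof.
move=> h0; have := state_realized h0; rewrite !state_of_rcons /A.
case: (state_of h) => K t /= sK; case: asboolP => // nK _ /=.
rewrite {3}/sched_potential /= (asboolF nK) /next_state /=.
have wL := wait_lt t sK nK; have wE := sched_wait t sK nK.
(* A [No] on an edge other than [es K] shortens the wait by one, which pays for the query. *)
have miss : sched K t != es K -> sched_potential (K, t.+1) + 1 <=
    Psi K - (L K)%:R + (wait K t)%:R + 1.
  move=> ne; rewrite /sched_potential /= (asboolF nK) lerD2r -addrA lerD2l natr1.
  rewrite ler_nat; case: (wait K t) wL wE => [|w] wL wE.
    by rewrite addn0 in wE; rewrite wE eqxx in ne.
  by rewrite ltnS; apply: wait_least; rewrite ?addSnnS ?wE // ltnW.
have [eR|eR] := ifP; last first.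
  rewrite mul0r add0r mul1r addrC; apply: miss.
  by apply: contraFneq eR => ->; apply: es_realized.
have hit : sched_potential (sched K t |: K, 0) <= Psi K - (L K)%:R / (1 - p).
  rewrite lerBrDr; apply: le_trans (Psi_drop sK nK eR).
  by rewrite lerD2r sched_potential_le // subUset sub1set eR.
have q_gt0 : 0 < 1 - p by rewrite subr_gt0.
have LE : (1 - p) * ((L K)%:R / (1 - p)) = (L K)%:R by rewrite mulrC divfK // gt_eqF.
have hit' := ler_wpM2l (ltW q_gt0) hit; rewrite mulrBr LE in hit'.
(* After a [No] on [es K] itself the wait starts afresh, with potential at most [Psi K]; the [Yes]
   branch contributes the missing [- L K]. *)
have [E1|ne] := eqVneq (sched K t) (es K).
  have K1 := ler_wpM2l p_ge0 (sched_potential_le t.+1 sK).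
  have : 0 <= (wait K t)%:R :> R by [].
  lra.
have K1 := ler_wpM2l p_ge0 (miss ne).
have : 0 <= (1 - p) * (wait K t)%:R by rewrite mulr_ge0 // ltW.
have : 0 <= p * (L K)%:R by rewrite mulr_ge0.
lra.
Qed.

Lemma sched_correct : Rz \subset E -> always_correct E p Rz A.
Proof.
move=> sRE h T h0; rewrite /A; case: asboolP => // cK [<-].
have [sT [cT aT]] := tree_ofP cK.
have sTR := subset_trans sT (state_realized h0).
by split=> //; split=> //; apply: subset_trans sRE.
Qed.

Lemma sched_finds : Rz \subset E ->
  [/\ always_correct E p Rz A, terminates_as p Rz A
    & (expected_queries p Rz A <= (Psi set0)%:E)%E].
Proof.
move=> sRE; have p_le1 := ltW p_lt1.
have Phi_ge0 h : 0 < prob h -> 0 <= sched_potential (state_of h).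
  by move=> /state_realized; case: state_of => K t; apply: sched_potential_ge0.
split; first exact: sched_correct.
- exact: (drift_terminates p_ge0 p_le1 sched_no_flip Phi_ge0 sched_potential_drift).
- apply: le_trans (drift_expected_queries p_ge0 p_le1 sched_no_flip Phi_ge0
    sched_potential_drift) _.
  by rewrite lee_fin sched_potential_le ?sub0set.
Qed.

End ScheduledQueries.

(* Waiting for a "Yes" costs at most [L / (1 - p)] queries in expectation, as
   one realized edge is tried in any [L] consecutive ones; the drop of [Psi]
   pays for them. *)
Lemma potential_strategy (V : finType) (R : realType) (p : R)
    (E : {set {set V}}) (Psi : {set {set V}} -> R) :
  0 <= p -> p < 1 -> (forall K, 0 <= Psi K) ->
  (forall K : {set {set V}}, K \subset E -> ~ gconnected K -> exists s : nat -> {set V},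
    forall Rz : {set {set V}}, Rz \subset E -> gconnected Rz -> K \subset Rz ->
    exists (L : nat) (e : {set V}), [/\ e \in Rz,
      forall t, exists j, (j < L)%N && (s (t + j)%N == e)
    & forall t, s t \in Rz -> Psi (s t |: K) + L%:R / (1 - p) <= Psi K]) ->
  exists A : strategy V, finds_tree_within E p A (Psi set0).
Proof.
move=> p0 p1 Psi0 H.
have /choice[sched schedP] : forall K : {set {set V}}, exists s : nat -> {set V},
    K \subset E -> ~ gconnected K ->
    forall Rz : {set {set V}}, Rz \subset E -> gconnected Rz -> K \subset Rz ->
    exists (Le : nat * {set V}), [/\ Le.2 \in Rz,
      forall t, exists j, (j < Le.1)%N && (s (t + j)%N == Le.2)
    & forall t, s t \in Rz -> Psi (s t |: K) + Le.1%:R / (1 - p) <= Psi K].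
  move=> K; have [[sK nK]|nH] := pselect (K \subset E /\ ~ gconnected K); last first.
    by exists (fun=> set0) => sK nK; case: nH.
  have [s sP] := H K sK nK; exists s => _ _ Rz sR cR sKR.
  by have [L [e LeP]] := sP Rz sR cR sKR; exists (L, e).
exists (sched_strategy sched) => Rz sR cR.
(* The schedule was chosen before [Rz] was introduced; the window and the edge may depend on
   [Rz]. *)
have /choice[Le LeP] : forall K : {set {set V}}, exists Le : nat * {set V},
    K \subset Rz -> ~ gconnected K -> [/\ Le.2 \in Rz,
      forall t, exists j, (j < Le.1)%N && (sched K (t + j)%N == Le.2)
    & forall t, sched K t \in Rz -> Psi (sched K t |: K) + Le.1%:R / (1 - p) <= Psi K].
  move=> K; have [[sK nK]|nH] := pselect (K \subset Rz /\ ~ gconnected K); last first.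
    by exists (0%N, set0) => sK nK; case: nH.
  have [le leP] := schedP K (subset_trans sK sR) nK Rz sR cR sK.
  by exists le.
apply: (@sched_finds _ _ _ _ Psi p0 p1 Psi0 _ _ (fun K => (Le K).1) (fun K => (Le K).2)).
- by move=> K sK nK; case: (LeP K sK nK).
- by move=> K t sK nK; case: (LeP K sK nK).
- by move=> K t sK nK; case: (LeP K sK nK) => _ _; apply.
- exact: sR.
Qed.

(** * Round robin over bundles of edges *)

Lemma window_visits (L a t : nat) : (a < L)%N ->
  exists j, (j < L)%N && ((t + j) %% L == a)%N.
Proof.
move=> aL; have L0 : (0 < L)%N by apply: leq_trans aL.
(* This is [a - t] modulo [L], written so that the natural subtraction does not truncate. *)
exists ((a + (L - t %% L)) %% L)%N; rewrite ltn_mod L0 /=.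
rewrite modnDmr -modnDml addnCA subnKC; last by rewrite ltnW // ltn_mod.
by rewrite modnDr modn_small.
Qed.

Section RoundRobin.
Variable T : eqType.

Implicit Types (x : T) (s : seq T) (ss : seq (seq T)) (t : nat).

(** Each list cycles at its own pace: an entry of [s] recurs within [size ss * size s] turns,
    whatever the lengths of the other lists. *)
Definition round_robin (x0 : T) (ss : seq (seq T)) (t : nat) : T :=
  let s := nth [::] ss (t %% size ss)%N in nth x0 s ((t %/ size ss) %% size s)%N.

Lemma round_robin_mem x0 ss t : ss != [::] -> {in ss, forall s, s != [::]} ->
  exists2 s, s \in ss & round_robin x0 ss t \in s.
Proof.
rewrite -size_eq0 -lt0n => ss0 s0.
have sP : nth [::] ss (t %% size ss)%N \in ss by rewrite mem_nth // ltn_mod.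
exists (nth [::] ss (t %% size ss)%N) => //.
by rewrite mem_nth // ltn_mod lt0n size_eq0 s0.
Qed.

Lemma round_robin_visits x0 ss s x t : s \in ss -> x \in s ->
  exists j, (j < size ss * size s)%N && (round_robin x0 ss (t + j) == x).
Proof.
move=> sss xs; pose i := index s ss; pose k := index x s.
have il : (i < size ss)%N by rewrite index_mem.
have kl : (k < size s)%N by rewrite index_mem.
(* Modulo the period of [s], this is a time at which entry [k] of list [i] comes up. *)
have al : (k * size ss + i < size ss * size s)%N by nia.
have [j /andP[jl /eqP jE]] := window_visits t al; exists j; rewrite jl /=.
have ss0 : (0 < size ss)%N by apply: leq_trans il.
have := divn_eq (t + j) (size ss * size s); rewrite jE.
set q := ((t + j) %/ _)%N => tE.
have {}tE : (t + j = (q * size s + k) * size ss + i)%N by rewrite tE; nia.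
rewrite /round_robin tE modnMDl modn_small // divnMDl // divn_small // addn0.
by rewrite nth_index // modnMDl modn_small // nth_index.
Qed.

End RoundRobin.

(* [ss] lists the bundles of parallel edges leaving the component of [x]. With
   [w] the size of the smallest bundle containing a realized edge, one such edge
   is tried every [size ss * w] queries, while any "Yes" comes from a bundle of
   size at least [w]; so the bundle of the answer bounds the waiting time. *)
Lemma bundle_strategy (V : finType) (R : realType) (p : R)
    (E : {set {set V}}) (Psi : {set {set V}} -> R) :
  0 <= p -> p < 1 -> (forall K, 0 <= Psi K) ->
  (forall K : {set {set V}}, K \subset E -> ~ gconnected K ->
    exists (x : V) (ss : seq (seq {set V})),
    [/\ {in ss, forall s, s != [::]},
      forall a b, [set a; b] \in E -> connect (sadj K) x a ->
        ~~ connect (sadj K) x b -> exists2 s, s \in ss & [set a; b] \in s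
    & forall s e, s \in ss -> e \in s ->
        Psi (e |: K) + (size ss * size s)%:R / (1 - p) <= Psi K]) ->
  exists A : strategy V, finds_tree_within E p A (Psi set0).
Proof.
move=> p0 p1 Psi0 H; apply: potential_strategy => // K sKE nK.
have [x [ss [ss_nil ss_cover Psi_drop]]] := H K sKE nK.
exists (round_robin set0 ss) => Rz sRE cR sKR.
pose hit n := has (fun s => (size s == n) && has (mem Rz) s) ss.
have hit_ex : exists n, hit n.
  have [a [b [abR xa nxb]]] := realized_leaving x cR nK.
  have [s sss abs] := ss_cover a b (subsetP sRE _ abR) xa nxb.
  exists (size s); apply/hasP; exists s => //; rewrite eqxx.
  by apply/hasP; exists [set a; b].
case: (ex_minnP hit_ex) => n /hasP[s sss /andP[/eqP sn /hasP[e es eR]]] minn.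
exists (size ss * size s)%N, e; split=> // [t|t tR].
  exact: round_robin_visits.
have ss0 : ss != [::] by case: (ss) sss.
have [s' s'ss ts'] := round_robin_mem set0 t ss0 ss_nil.
apply: le_trans (Psi_drop s' _ s'ss ts').
rewrite lerD2l ler_wpM2r ?invr_ge0 ?subr_ge0 ?(ltW p1) //.
rewrite ler_nat leq_mul2l sn minn ?orbT //.
apply/hasP; exists s' => //; rewrite eqxx /=.
by apply/hasP; exists (round_robin set0 ss t).
Qed.

(** * Averaging, and the components of the known edges *)

Lemma finds_tree_within_le (V : finType) (R : realType) (p : R)
    (E : {set {set V}}) (A : strategy V) (B B' : R) :
  B <= B' -> finds_tree_within E p A B -> finds_tree_within E p A B'.
Proof.
move=> BB' H Rz sR cR; have [? ? q] := H Rz sR cR; split=> //.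
by apply: le_trans q _; rewrite lee_fin.
Qed.

(** Double counting of incidences: the minimal degree is at most the average, here without
    division. *)
Lemma exists_small_incidence (X Y : finType) (P : {set X}) (E : {set Y})
    (r : X -> Y -> bool) (k : nat) :
  P != set0 -> {in E, forall e, (#|[set x in P | r x e]| <= k)%N} ->
  exists2 x, x \in P & (#|P| * #|[set e in E | r x e]| <= k * #|E|)%N.
Proof.
case/set0Pn=> x0 x0P rk.
pose d x := #|[set e in E | r x e]|.
have sum_le : (\sum_(x in P) d x <= k * #|E|)%N.
  have dE x : x \in P -> d x = (\sum_(e in E) r x e)%N.
    by move=> _; rewrite /d -sum1_card big_mkcond /= [RHS]big_mkcond;
       apply: eq_bigr => e _; rewrite inE; case: (e \in E) (r x e) => [] [].
  rewrite (eq_bigr _ dE) exchange_big /= mulnC -sum_nat_const.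
  apply: leq_sum => e eE; apply: leq_trans (rk e eE).
  rewrite -sum1_card big_mkcond /= [X in (_ <= X)%N]big_mkcond.
  by apply: leq_sum => x _; rewrite inE; case: (x \in P) (r x e) => [] [].
case: (arg_minnP d x0P) => x xP minx; exists x => //.
apply: leq_trans sum_le; rewrite -sum_nat_const.
exact: leq_sum.
Qed.

Section Components.
Variable V : finType.
Implicit Types (E K : {set {set V}}) (x u v : V).

Definition comps K : {set V} := [set fingraph.root (sadj K) x | x in [set: V]].

Lemma comps_root K x : fingraph.root (sadj K) x \in comps K.
Proof. exact: imset_f. Qed.

Lemma comps_rootK K x : x \in comps K -> fingraph.root (sadj K) x = x.
Proof. by case/imsetP => y _ ->; apply/root_root/sadj_connect_sym. Qed.

Lemma root_sadjE K x y :
  (fingraph.root (sadj K) x == fingraph.root (sadj K) y) = connect (sadj K) x y.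
Proof. exact/root_connect/sadj_connect_sym. Qed.

Lemma card_comps_le K : (#|comps K| <= #|V|)%N.
Proof. by rewrite -cardsT; apply: leq_imset_card. Qed.

(** Taking roots for the larger edge set maps the old roots onto the new ones and identifies those
    of [u] and [v], so it is not injective. *)
Lemma card_comps_merge K u v : ~~ connect (sadj K) u v ->
  (#|comps ([set u; v] |: K)| < #|comps K|)%N.
Proof.
move=> nuv; set K' := _ |: K.
have sK : K \subset K' by apply: subsetUr.
have rr x : fingraph.root (sadj K') (fingraph.root (sadj K) x) = fingraph.root (sadj K') x.
  apply/eqP; rewrite root_sadjE; apply: (connect_sadj_sub sK).
  by rewrite sadj_connect_sym connect_root.
have -> : comps K' = fingraph.root (sadj K') @: comps K.
  by rewrite /comps -imset_comp; apply: eq_imset => x /=; rewrite rr.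
rewrite ltn_neqAle leq_imset_card andbT; apply/negP => /imset_injP inj.
have uv : u != v by apply: contraNneq nuv => ->.
have := inj _ _ (comps_root K u) (comps_root K v).
rewrite !rr => H; move: nuv; rewrite -root_sadjE H ?eqxx //.
by apply/eqP; rewrite root_sadjE connect_add_edge.
Qed.

Definition leaving E K x : {set {set V}} :=
  [set e in E | [exists a in e, exists b in e,
     connect (sadj K) x a && ~~ connect (sadj K) x b]].

(** An edge can leave only the components of its two ends, so the averaging applies with [k = 2]. *)
Lemma exists_small_boundary E K : simple_edges E -> (0 < #|V|)%N ->
  exists x, (#|comps K| * #|leaving E K x| <= 2 * #|E|)%N.
Proof.
move=> sE /card_gt0P[x0 _].
have [||x _ xP] := @exists_small_incidence _ _ (comps K) E (fun x e =>
  [exists a in e, exists b in e, connect (sadj K) x a && ~~ connect (sadj K) x b]) 2.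
- by apply/set0Pn; exists (fingraph.root (sadj K) x0); apply: comps_root.
- move=> e eE; rewrite -(sE e eE); apply: leq_trans (leq_imset_card (fingraph.root (sadj K)) e).
  apply: subset_leq_card; apply/subsetP => x; rewrite inE => /andP[xP].
  case/exists_inP => a ae /exists_inP[b _ /andP[xa _]].
  by apply/imsetP; exists a => //; rewrite -(comps_rootK xP); apply/eqP; rewrite root_sadjE.
- by exists x.
Qed.

Lemma leaving_pair E K x e : simple_edges E -> e \in leaving E K x ->
  exists a b, e = [set a; b] /\ ~~ connect (sadj K) a b.
Proof.
move=> sE; rewrite inE => /andP[eE /exists_inP[a ae /exists_inP[b be /andP[xa nxb]]]].
have nab : ~~ connect (sadj K) a b.
  by apply: contra nxb; apply: connect_trans.
have ab : a != b by apply: contraNneq nab => ->.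
exists a, b; split=> //; apply/esym/eqP; rewrite eqEcard (sE e eE) cards2 ab andbT.
by rewrite subUset !sub1set ae be.
Qed.

Lemma notconnected_card K : ~ gconnected K -> (0 < #|V|)%N.
Proof.
move=> nK; rewrite lt0n; apply/negP => /eqP/card0_eq V0; apply: nK => x.
by have := V0 x.
Qed.

End Components.

(** * Harmonic sums and the bound for general graphs *)

Section Harmonic.
Variable R : realType.

(** The harmonic number without its first term, [1/2 + ... + 1/n]: it vanishes at one component and
    is at most [ln n] with no additive constant. *)
Definition harm (n : nat) : R := \sum_(1 <= i < n) (i.+1%:R)^-1.

Lemma harmS n : (0 < n)%N -> harm n.+1 = harm n + (n.+1%:R)^-1.
Proof. by move=> n0; rewrite /harm big_nat_recr. Qed.

Lemma harm_ge0 n : 0 <= harm n.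
Proof. by apply: sumr_ge0 => i _; rewrite invr_ge0. Qed.

Lemma harm_lt m n : (0 < m)%N -> (m < n)%N -> harm m + n%:R^-1 <= harm n.
Proof.
move=> m0; elim: n => // n IH; rewrite ltnS leq_eqVlt => /orP[/eqP <-|mn].
  by rewrite harmS.
rewrite harmS; last by apply: leq_trans mn.
rewrite lerD2r; apply: le_trans (IH mn).
by rewrite lerDl invr_ge0.
Qed.

Lemma harm_le_ln n : harm n <= ln n%:R.
Proof.
case: n => [|n]; first by rewrite /harm big_geq // ln0.
elim: n => [|n IH]; first by rewrite /harm big_geq // ln1.
rewrite harmS //.
have n1 : 0 < n.+1%:R :> R by [].
have n2 : 0 < n.+2%:R :> R by [].
suff : (n.+2%:R)^-1 <= ln n.+2%:R - ln n.+1%:R :> R.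
  by move=> H; apply: le_trans (lerD IH H) _; rewrite addrC subrK.
(* [ln (1 + x) <= x] at [x = - 1 / (n + 2)], where [1 + x = (n + 1) / (n + 2)]. *)
have := @le_ln1Dx R (- (n.+2%:R)^-1).
rewrite ltrN2 invf_lt1 // ltr1n => /(_ isT).
have -> : 1 - (n.+2%:R)^-1 = n.+1%:R / n.+2%:R :> R.
  have n2' := lt0r_neq0 n2.
  by apply: (mulIf n2'); rewrite mulrBl divfK // mulVf // mul1r -(natr1 n.+1) addrK.
by rewrite ln_div ?posrE // => H; rewrite -lerN2 opprB.
Qed.

End Harmonic.

Lemma strategy_log (R : realType) (p : R) (V : finType) (E : {set {set V}}) :
  0 <= p -> p < 1 -> simple_edges E ->
  exists A : strategy V,
    finds_tree_within E p A (2 / (1 - p) * #|E|%:R * ln (#|V|%:R)).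
Proof.
move=> p0 p1 sE.
have q_gt0 : 0 < 1 - p by rewrite subr_gt0.
pose c := 2 / (1 - p) * #|E|%:R.
have c_ge0 : 0 <= c by rewrite /c !mulr_ge0 // invr_ge0 ltW.
(* With [k] components, the single bundle of at most [2m/k] leaving edges costs at most [c / k], the
   term that [harm] loses in a merge. *)
pose Psi (K : {set {set V}}) : R := c * harm R #|comps K|.
have [||A fA] := @bundle_strategy V R p E Psi p0 p1.
- by move=> K; rewrite mulr_ge0 ?harm_ge0.
- move=> K _ nK.
  have [x xP] := exists_small_boundary K sE (notconnected_card nK).
  set D := leaving E K x in xP.
  have cover a b : [set a; b] \in E -> connect (sadj K) x a ->
      ~~ connect (sadj K) x b -> [set a; b] \in D.
    move=> abE xa nxb; rewrite inE abE; apply/exists_inP; exists a; first exact: set21.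
    by apply/exists_inP; exists b; rewrite ?set22 ?xa.
  (* Bundles must be nonempty, so an empty boundary is given no bundle at all. *)
  exists x; have [D0|D0] := eqVneq D set0.
    by exists [::]; split=> // a b abE xa nxb; have := cover a b abE xa nxb; rewrite D0 inE.
  exists [:: enum D]; split.
  + by move=> s; rewrite inE => /eqP ->; rewrite -size_eq0 -cardE cards_eq0.
  + by move=> a b *; exists (enum D); rewrite ?inE // mem_enum cover.
  move=> s e; rewrite inE => /eqP ->; rewrite mem_enum mul1n -cardE => eD.
  have [a [b [-> nab]]] := leaving_pair sE eD.
  have K'0 : (0 < #|comps ([set a; b] |: K)|)%N.
    by apply/card_gt0P; exists (fingraph.root (sadj ([set a; b] |: K)) x); apply: comps_root.
  have lt := card_comps_merge nab.
  apply: le_trans (ler_wpM2l c_ge0 (harm_lt R K'0 lt)).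
  rewrite mulrDr lerD2l ler_pdivlMr ?ltr0n; last exact: leq_trans lt.
  rewrite mulrAC ler_pdivrMr // /c mulrAC divfK ?gt_eqF //.
  by rewrite -!natrM ler_nat mulnC.
- exists A; apply: finds_tree_within_le fA; rewrite ler_wpM2l //.
  apply: le_trans (harm_le_ln R _) _.
  (* Monotonicity of [ln] needs positive arguments; at 0 its value is 0. *)
  have [V0|V0] := posnP #|comps (set0 : {set {set V}})|.
    rewrite V0 [leLHS]ln0 //; case: #|V| => [|n]; first by rewrite ln0.
    by rewrite ln_ge0 // ler1n.
  rewrite ler_ln ?posrE ?ltr0n ?ler_nat ?card_comps_le //.
  exact: leq_trans V0 (card_comps_le _).
Qed.

(** * Contracting the components yields a minor *)

Lemma minor_refl (G : graph) : minor G G.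
Proof.
apply: minor_iso; exists id; split; first by exists id.
apply/setP => e; apply/idP/imsetP => [eG|[f fG ->]]; last by rewrite imset_id.
by exists e; rewrite ?imset_id.
Qed.

(** The edges of [K] are contracted one at a time, skipping an edge whose ends are already
    identified. Parallel edges get the same image under [pi], and loops disappear by the cardinality
    condition. *)
Lemma quotient_minor (G : graph) (K : {set {set gV G}}) :
  simple_edges (gE G) -> K \subset gE G ->
  exists (H : graph) (pi : gV G -> gV H),
    [/\ minor H G, forall h, exists x, pi x = h,
        forall x y, (pi x == pi y) = connect (sadj K) x y
      & gE H = [set pi @: (e : {set gV G}) | e in gE G & #|pi @: (e : {set gV G})| == 2%N]].
Proof.
move=> sE; have [n] := ubnP #|K|; elim: n K => // n IH K.
have [->|/set0Pn[e eK]] := eqVneq K set0.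
  move=> _ _; exists G, id; split.
  - exact: minor_refl.
  - by move=> h; exists h.
  - move=> x y; apply/eqP/idP => [->|]; first exact: connect0.
    by apply: connect_invariant => a b; rewrite /sadj inE andbF.
  - apply/setP => e; apply/idP/imsetP => [eG|[f]].
      by exists e; rewrite ?inE ?imset_id ?eG ?(sE _ eG).
    by rewrite inE imset_id => /andP[fG _] ->.
rewrite ltnS => Kn sK.
have eE := subsetP sK _ eK.
have [||H [pi [mH surj piE gEH]]] := IH (K :\ e).
- by apply: leq_trans Kn; rewrite [X in (_ < X)%N](cardsD1 e) eK.
- by apply: subset_trans sK; apply: subsetDl.
have /cards2P[u [v [uv eV]]] : #|e| == 2%N by rewrite (sE e eE).
have KE : K = e |: (K :\ e) by rewrite setD1K.
have [puv|puv] := eqVneq (pi u) (pi v).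
  exists H, pi; split=> // x y; rewrite piE; apply/idP/idP.
    by apply: connect_sadj_sub; apply: subsetDl.
  by move/eqP: puv; rewrite piE eV => cuv; apply: (connect_remove_redundant cuv).
have euv : [set pi u; pi v] \in gE H.
  rewrite gEH; apply/imsetP; exists e; last by rewrite eV imsetU1 imset_set1.
  by rewrite inE eE eV imsetU1 imset_set1 cards2 puv.
(* [contract] keeps its first vertex and removes the second, so the projection is redirected from
   [pi v] to [pi u]. *)
pose q (h : gV H) := if h == pi v then pi u else h.
have qP x : q (pi x) != pi v by rewrite /q; case: ifPn.
pose pi' x : gV (Defs.contract (pi u) (pi v)) := Sub (q (pi x)) (qP x).
have val_pi' (f : {set gV G}) : val @: (pi' @: f) = q @: (pi @: f).
  by rewrite -!imset_comp.
exists (Defs.contract (pi u) (pi v)), pi'; split.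
- exact: minor_trans (minor_contract puv euv) mH.
- move=> h; have [x xh] := surj (val h); exists x; apply: val_inj => /=.
  by rewrite /q xh (negPf (valP h)).
- have sKe : K :\ e \subset K by apply: subsetDl.
  (* Redirection stays within a component of [K], because the contracted edge [uv] lies in [K]. *)
  have step x : exists2 x', q (pi x) = pi x' & connect (sadj K) x x'.
    rewrite /q; have [xv|_] := eqVneq (pi x) (pi v); last by exists x.
    exists u => //; apply: (@connect_trans _ _ v).
      by apply: (connect_sadj_sub sKe); rewrite -piE xv.
    by rewrite sadj_connect_sym KE eV; apply: connect_add_edge.
  move=> x y; apply/eqP/idP => [[qxy]|].
    have [x' xE cx] := step x; have [y' yE cy] := step y.
    apply: connect_trans cx _; rewrite sadj_connect_sym; apply: connect_trans cy _.
    by apply: (connect_sadj_sub sKe); rewrite -piE -xE -yE qxy.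
  move=> cxy; apply: val_inj => /=; apply: (connect_invariant (f := q \o pi)) cxy.
  move=> a b /andP[ab abK] /=.
  have [abe|abe] := eqVneq [set a; b] e.
    have qu : q (pi u) = pi u by rewrite /q (negPf puv).
    have qv : q (pi v) = pi u by rewrite /q eqxx.
    have aE : a \in [set u; v] by rewrite -eV -abe set21.
    have bE : b \in [set u; v] by rewrite -eV -abe set22.
    by move: aE bE; rewrite !inE => /orP[]/eqP-> /orP[]/eqP->; rewrite ?qu ?qv.
  congr q; apply/eqP; rewrite piE; apply: connect1.
  by rewrite /sadj ab !inE abe.
- apply/setP => f; rewrite inE; apply/andP/imsetP.
    move=> [f2 /exists_inP[g]]; rewrite gEH => /imsetP[e' e'E ->] /eqP gf.
    move: e'E; rewrite inE => /andP[e'E _].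
    have fE : f = pi' @: (e' : {set gV G}).
      by apply: (imset_inj val_inj); rewrite val_pi' -gf.
    by exists e'; rewrite // inE e'E -fE.
  move=> [e']; rewrite inE => /andP[e'E f2] ->; split=> //.
  apply/exists_inP; exists (pi @: (e' : {set gV G})); last by rewrite val_pi'.
  rewrite gEH; apply/imsetP; exists e' => //; rewrite inE e'E /=.
  (* The size of [pi @: e'] is squeezed between those of [pi' @: e'] and [e'], both 2. *)
  rewrite eqn_leq -{1}(sE _ e'E) leq_imset_card /= -(eqP f2).
  by rewrite -(card_imset _ val_inj) val_pi' leq_imset_card.
Qed.

(** * Edges between components and the bound for sparse minor-closed families *)

Section Crossing.
Variable V : finType.
Implicit Types (E K B : {set {set V}}).

Definition crossing E K : {set {set V}} :=
  [set e in E | ~~ [forall a in e, forall b in e, connect (sadj K) a b]].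

Lemma crossingS E K K' : K \subset K' -> crossing E K' \subset crossing E K.
Proof.
move=> sK; apply/subsetP => e; rewrite !inE => /andP[-> /=]; apply: contra.
move=> /forall_inP H; apply/forall_inP => a ae; apply/forall_inP => b be.
exact: (connect_sadj_sub sK) (forall_inP (H a ae) b be).
Qed.

(** Edges of [B] no longer cross for [K'], so [B] is disjoint from [crossing E K'] inside
    [crossing E K]. *)
Lemma card_crossing_bundle E K K' B : K \subset K' -> B \subset crossing E K ->
  (forall (e : {set V}) a b, e \in B -> a \in e -> b \in e ->
    connect (sadj K') a b) ->
  (#|crossing E K'| + #|B| <= #|crossing E K|)%N.
Proof.
move=> sK sB HB; rewrite -(leq_add2r 0) addn0 -cardsUI.
have -> : crossing E K' :&: B = set0.
  apply/setP => e; rewrite !inE; apply/negP => /andP[/andP[_ /negP nc] eB]; apply: nc.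
  by apply/forall_inP => a ae; apply/forall_inP => b be; apply: HB eB ae be.
by rewrite cards0 addn0 addn0 subset_leq_card // subUset crossingS.
Qed.

End Crossing.

Lemma strategy_sparse (R : realType) (p rho : R) (F : graph -> Prop) (G : graph) :
  0 <= p -> p < 1 -> minor_closed F -> (forall G, F G -> sparse rho G) ->
  F G -> simple_edges (gE G) ->
  exists A : strategy (gV G),
    finds_tree_within (gE G) p A (2 / (1 - p) * rho * #|gE G|%:R).
Proof.
move=> p0 p1 Fminor Fsparse FG sE.
have q_gt0 : 0 < 1 - p by rewrite subr_gt0.
pose c := 2 / (1 - p) * rho.
pose Psi (K : {set {set gV G}}) : R := c * #|crossing (gE G) K|%:R.
have cross_le K : (#|crossing (gE G) K| <= #|gE G|)%N.
  by apply/subset_leq_card/subsetP => e; rewrite inE => /andP[].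
(* On an empty vertex set [rho] could be negative. An edge provides a vertex, and sparsity then
   gives the sign; without edges [Psi] is 0. *)
have c_ge0 : (0 < #|gE G|)%N -> 0 <= c.
  case/card_gt0P => e eE; have V0 : (0 < #|gV G|)%N.
    by apply: leq_trans (max_card e); rewrite sE.
  have := Fsparse G FG; rewrite /sparse => /(le_trans (ler0n _ _)).
  by rewrite pmulr_lge0 ?ltr0n // => ?; rewrite !mulr_ge0 ?invr_ge0 // ltW.
have Psi_ge0 K : 0 <= Psi K.
  have [E0|E0] := posnP #|gE G|; last by rewrite mulr_ge0 ?c_ge0.
  by have := cross_le K; rewrite E0 leqn0 /Psi => /eqP ->; rewrite mulr0.
have [|A fA] := @bundle_strategy (gV G) R p (gE G) Psi p0 p1 Psi_ge0; last first.
  exists A; apply: finds_tree_within_le fA; rewrite /Psi.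
  have [E0|E0] := posnP #|gE G|; last by rewrite ler_wpM2l ?c_ge0 // ler_nat.
  by have := cross_le set0; rewrite E0 leqn0 => /eqP ->; rewrite !mulr0.
move=> K sK nK.
have [H [pi [mH surj piE gEH]]] := quotient_minor sE sK.
have H2 f : f \in gE H -> #|f| = 2%N.
  by rewrite gEH => /imsetP[e]; rewrite inE => /andP[_ /eqP e2] ->.
have /card_gt0P[x0 _] := notconnected_card nK.
(* A vertex of minimal degree in the quotient; sparsity of this minor bounds its degree by
   [2 * rho]. *)
have [||h _ hP] := @exists_small_incidence _ _ [set: gV H] (gE H) (fun h f => h \in f) 2.
- by apply/set0Pn; exists (pi x0); rewrite inE.
- move=> f /H2 <-; apply: subset_leq_card; apply/subsetP => h.
  by rewrite inE => /andP[].
set Fh := [set f in gE H | h \in f] in hP.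
have degree_le : #|Fh|%:R <= 2 * rho.
  have := Fsparse H (Fminor _ _ FG mH); rewrite /sparse => HS.
  have VH0 : 0 < #|gV H|%:R :> R.
    by rewrite ltr0n; apply/card_gt0P; exists h.
  rewrite -(ler_pM2l VH0) -natrM mulrCA (mulrC _ rho).
  apply: le_trans (_ : (2 * #|gE H|)%:R <= _); last by rewrite natrM ler_pM2l.
  by rewrite ler_nat -cardsT.
(* The bundle of parallel edges of [G] that merge into the edge [f] of the quotient. *)
pose B f := [set e in gE G | pi @: (e : {set gV G}) == f].
have [x xh] := surj h.
exists x, [seq enum (B f) | f <- enum Fh]; split.
- move=> s /mapP[f]; rewrite mem_enum inE => /andP[fH _] ->.
  move: fH; rewrite gEH => /imsetP[e]; rewrite inE => /andP[eE _] fE.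
  rewrite -size_eq0 -cardE cards_eq0; apply/set0Pn; exists e.
  by rewrite inE eE fE /=.
- move=> a b abE xa nxb; exists (enum (B (pi @: [set a; b]))); last first.
    by rewrite mem_enum inE abE /=.
  apply/mapP; exists (pi @: [set a; b]) => //; rewrite mem_enum inE gEH.
  move: xa nxb; rewrite -!piE xh => /eqP ha hb.
  apply/andP; split; last by rewrite ha imset_f ?set21.
  apply/imsetP; exists [set a; b] => //.
  by rewrite inE abE imsetU1 imset_set1 cards2 -ha hb.
move=> s e /mapP[f]; rewrite mem_enum => fFh ->; rewrite mem_enum => eB.
have fH : f \in gE H by move: fFh; rewrite inE => /andP[].
(* A [Yes] on [e] joins the two components at the ends of [f], so the whole bundle stops
   crossing. *)
have drop : (#|crossing (gE G) (e |: K)| + #|B f| <= #|crossing (gE G) K|)%N.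
  apply: card_crossing_bundle.
  - exact: subsetUr.
  - apply/subsetP => e'; rewrite !inE => /andP[e'E /eqP e'f]; rewrite e'E /=.
    apply/negP => /forall_inP all_conn.
    have /cards2P[a [b [ab fab]]] : #|f| == 2%N by rewrite (H2 _ fH).
    have : a \in f by rewrite fab set21.
    have : b \in f by rewrite fab set22.
    rewrite -e'f => /imsetP[b' b'e bE] /imsetP[a' a'e aE].
    have := forall_inP (all_conn a' a'e) b' b'e.
    by rewrite -piE -aE -bE (negPf ab).
  move=> e' a b e'B ae be.
  (* Both edges project to [f], so each end of [e'] shares its component with an end of [e]. *)
  have lift z : z \in e' -> exists2 w, w \in e & connect (sadj (e |: K)) z w.
    move=> ze; move: eB e'B; rewrite !inE => /andP[_ /eqP ef] /andP[_ /eqP e'f].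
    have : pi z \in pi @: e by rewrite ef -e'f imset_f.
    case/imsetP => w we /eqP; rewrite piE => zw; exists w => //.
    exact: (connect_sadj_sub (subsetUr _ _)) zw.
  have [a' a'e ca] := lift a ae; have [b' b'e cb] := lift b be.
  apply: connect_trans ca _; rewrite sadj_connect_sym; apply: connect_trans cb _.
  have [->|ab] := eqVneq b' a'; first exact: connect0.
  have eE : e \in gE G by move: eB; rewrite inE => /andP[].
  have -> : e = [set b'; a'].
    apply/esym/eqP; rewrite eqEcard (sE _ eE) cards2 ab andbT.
    by rewrite subUset !sub1set b'e a'e.
  exact: connect_add_edge.
rewrite size_map -!cardE natrM /Psi.
have cE : c = (2 * rho) / (1 - p) by rewrite /c mulrAC.
have le1 : #|Fh|%:R * #|B f|%:R / (1 - p) <= c * #|B f|%:R.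
  rewrite cE mulrAC ler_wpM2r // ler_wpM2r ?invr_ge0 //.
  exact: ltW.
have c0 : 0 <= c.
  by rewrite cE mulr_ge0 ?invr_ge0 ?(ltW q_gt0) // (le_trans _ degree_le).
apply: le_trans (lerD (lexx _) le1) _.
by rewrite -mulrDr ler_wpM2l // -natrD ler_nat.
Qed.

Theorem theorem3 (R : realType) (p : R) (hp0 : 0 <= p) (hp : p < 2^-1) :
  (exists C : R, forall (V : finType) (E : {set {set V}}), simple_edges E ->
     exists A : strategy V,
       finds_tree_within E p A (C * #|E|%:R * ln (#|V|%:R)))
  /\
  (exists C : R, forall (rho : R) (F : graph -> Prop),
     minor_closed F -> (forall G, F G -> sparse rho G) ->
     forall G : graph, F G -> simple_edges (gE G) ->
     exists A : strategy (gV G),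
       finds_tree_within (gE G) p A (C * rho * #|gE G|%:R)).
Proof.
have p1 : p < 1 by lra.
split; exists (2 / (1 - p)).
  by move=> V E; apply: strategy_log.
by move=> rho F Fminor Fsparse G FG; apply: (strategy_sparse hp0 p1 Fminor Fsparse FG).
Qed.
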